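(* Let $n\ge 3$ be an integer, let $C_n$ be the cyclic group of order $n$, and let $\lambda_2(\mathcal{P}(C_n))$ be the second largest eigenvalue of its power graph $\mathcal{P}(C_n)$. Then $\lambda_2(\mathcal{P}(C_n))\ge -1$, and equality holds if and only if $\mathcal{P}(C_n)$ is a complete graph.
   Context: The power graph $\mathcal{P}(\mathbb{G})$ of a finite group $\mathbb{G}$ is the simple undirected graph with vertex set $\mathbb{G}$ in which two distinct elements $x,y$ are adjacent if and only if one of them is an integral power of the other. The eigenvalues of a graph $G$ on $N$ vertices are those of its adjacency matrix, listed with multiplicity as $\lambda_1(G)\ge\lambda_2(G)\ge\cdots\ge\lambda_N(G)$; $\lambda_2(G)$ is the second largest eigenvalue. *)

(* Defs.v *)
From mathcomp Require Export all_boot all_order all_algebra all_fingroup.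
From mathcomp Require Export all_solvable polyrcf.
From mathcomp Require Import sesquilinear spectral complex.

Set Implicit Arguments.
Unset Strict Implicit.
Unset Printing Implicit Defensive.

Import Order.TTheory GRing.Theory Num.Theory.

Local Open Scope ring_scope.

(* A simple graph on a finite vertex type is a symmetric irreflexive boolean
   relation on it. *)

Definition complete_graph (T : finType) (e : rel T) : Prop :=
  forall x y : T, x != y -> e x y.

Definition adjacency_mx (R : rcfType) (T : finType) (e : rel T) :
    'M[R]_#|T| :=
  \matrix_(i, j) (e (enum_val i) (enum_val j))%:R.

(* For [p != 0], [rootsR p] is the increasing list of the distinct roots of [p]
   in [R], and [mup x p] is the multiplicity of [x] as a root of [p]. *)
Definition spectrum (R : rcfType) (m : nat) (A : 'M[R]_m) : seq R :=
  rev (flatten [seq nseq (mup x (char_poly A)) x | x <- rootsR (char_poly A)]).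

Section SymmetricSpectrum.

Local Open Scope complex_scope.

Lemma mup_prod_seq (R : fieldType) (s : seq R) x :
  mup x (\prod_(y <- s) ('X - y%:P)) = count_mem x s.
Proof.
elim: s => [|a s IH]; first by rewrite big_nil /= mupNroot // root1.
rewrite big_cons mupM ?IH /=; first by rewrite -['X - a%:P]expr1 mup_XsubCX; case: eqP.
- by rewrite polyXsubC_eq0.
- by apply/monic_neq0/monic_prod => i _; apply: monicXsubC.
Qed.

Lemma char_poly_symmetric_split (R : rcfType) m (A : 'M[R]_m) : A^T = A ->
  exists s : seq R, char_poly A = \prod_(x <- s) ('X - x%:P).
Proof.
move=> sA; set B := map_mx (real_complex R) A.
have Bh : B \is hermsymmx.
  apply: realsym_hermsym.
    by apply/is_hermitianmxP; rewrite expr0 scale1r map_mx_id // /B map_trmx sA.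
  apply/mxOverP => i j; rewrite !mxE; apply/CrealP. by rewrite /Num.conj /= oppr0.
have dr := hermitian_spectral_diag_real Bh.
have /hermitian_normalmx /orthomx_spectralP BE := Bh.
exists [seq complex.Re (spectral_diag B 0 i) | i <- enum 'I_m].
apply: (@map_poly_inj _ _ (real_complex R)).
rewrite map_char_poly -/B big_map big_enum /= rmorph_prod /=.
have -> : char_poly B = char_poly (diag_mx (spectral_diag B)).
  set P := spectralmx B in BE; set D := diag_mx _ in BE *.
  have Pu : P \in unitmx by apply: spectral_unit.
  rewrite /char_poly.
  have -> : char_poly_mx B = map_mx polyC (invmx P) *m char_poly_mx D *m map_mx polyC P.
    rewrite /char_poly_mx mulmxBr mulmxBl -!map_mxM -BE; congr (_ - _).
    by rewrite -mulmxA -scalar_mxC mulmxA -map_mxM mulVmx // map_mx1 mul1mx.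
  rewrite !det_mulmx mulrAC -det_mulmx -map_mxM mulVmx // map_mx1 det1 mul1r //.
rewrite char_poly_trig ?diag_mx_is_trig //; apply: eq_bigr => i _.
rewrite rmorphB /= map_polyX map_polyC /= !mxE eqxx mulr1n; congr (_ - _%:P).
by rewrite RRe_real //; move/mxOverP: dr.
Qed.

Lemma spectrum_symmetric (R : rcfType) m (A : 'M[R]_m) : A^T = A ->
  [/\ char_poly A = \prod_(x <- spectrum A) ('X - x%:P),
      sorted >=%R (spectrum A) & size (spectrum A) = m].
Proof.
move=> /char_poly_symmetric_split[s sE].
have nz : char_poly A != 0 by apply/monic_neq0/char_poly_monic.
have srt : sorted <%R (rootsR (char_poly A)) by apply: sorted_roots.
have pe : perm_eq (spectrum A) s.
  rewrite /spectrum perm_rev; apply/allP => x _ /=; apply/eqP.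
  rewrite count_flatten -map_comp.
  have -> : count_mem x s = mup x (char_poly A) by rewrite sE mup_prod_seq.
  have uq : uniq (rootsR (char_poly A)) by apply: (sorted_uniq lt_trans ltxx srt).
  rewrite (eq_map (_ : _ =1 fun y => (y == x) * mup y (char_poly A))%N); last first.
    by move=> y /=; rewrite count_nseq.
  rewrite sumnE big_map.
  case: (boolP (x \in rootsR (char_poly A))) => hx.
    rewrite (bigD1_seq x) //= eqxx mul1n big1 ?addn0 // => y /negPf ->; by rewrite mul0n.
  rewrite big1_seq => [|y /= hy].
    rewrite mupNroot //. have := roots_on_rootsR nz x. by rewrite (negPf hx) => /= ->.
  case: eqP => [yx|]; last by rewrite mul0n. by rewrite -yx hy in hx.
have pE : char_poly A = \prod_(x <- spectrum A) ('X - x%:P) by rewrite (perm_big _ pe).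
split=> //; last by have := size_char_poly A; rewrite pE size_prod_XsubC => -[].
rewrite /spectrum rev_sorted.
elim: (rootsR _) srt => //= a r IH; rewrite (path_sortedE lt_trans) => /andP[/allP al /IH h].
elim: (mup _ _) => //= k IHk. rewrite (path_sortedE le_trans) IHk andbT.
apply/allP => y; rewrite mem_cat => /orP[/nseqP[-> //]|/flattenP[t /mapP[z zr ->]] /nseqP[-> _]].
exact/ltW/al.
Qed.

End SymmetricSpectrum.

Lemma adjacency_mx_sym (R : rcfType) (T : finType) (e : rel T) :
  symmetric e -> (adjacency_mx R e)^T = adjacency_mx R e.
Proof. by move=> es; apply/matrixP => i j; rewrite !mxE es. Qed.

(* The eigenvalue lambda_k, numbered from 1 in nonincreasing order. For a
   simple graph and 1 <= k <= #|T| the default value of [nth] is not used, by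
   [adjacency_mx_sym] and [spectrum_symmetric]. *)
Definition graph_eigenvalue (R : rcfType) (T : finType) (e : rel T) (k : nat) :
    R :=
  nth 0 (spectrum (adjacency_mx R e)) k.-1.

Definition power_graph (gT : finGroupType) : rel gT :=
  fun x y => (x != y) && ((x \in <[y]>%g) || (y \in <[x]>%g)).

Lemma power_graphP (gT : finGroupType) (x y : gT) :
  reflect (x <> y /\ exists i : nat,
             [\/ x = y ^+ i, x = y ^- i, y = x ^+ i | y = x ^- i]%g)
          (power_graph x y).
Proof.
apply: (iffP andP) => [[/eqP xy /orP[]/cycleP[i xE]]|[/eqP xy [i h]]].
- by split=> //; exists i; constructor 1.
- by split=> //; exists i; constructor 3.
- split=> //; apply/orP.
  by case: h => ->; [left|left|right|right]; rewrite ?groupV mem_cycle.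
Qed.

Lemma power_graph_sym (gT : finGroupType) : symmetric (@power_graph gT).
Proof. by move=> x y; rewrite /power_graph eq_sym orbC. Qed.

Lemma power_graph_irrefl (gT : finGroupType) : irreflexive (@power_graph gT).
Proof. by move=> x; rewrite /power_graph eqxx. Qed.

(* Main.v *)
Require Import Defs.
From mathcomp Require Import lra.

Import Order.TTheory GRing.Theory Num.Theory.
Local Open Scope ring_scope.

(** The property is one of all simple graphs on [N >= 2] vertices.

    The eigenvalues sum to the trace of the adjacency matrix, which is 0
    ([sum_spectrum], [adjacency_mx_trace]).  If the second one is at most -1,
    then so are the [N - 1] last ones, and the first one must be at least
    [N - 1].  But [N - 1] bounds the number of neighbours of a vertex, so an
    eigenvalue that large makes the graph complete: in the equation of a largest
    entry of an eigenvector, every other vertex has to be a neighbour carrying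
    an entry of the same absolute value ([large_eigenvalue_complete]).
    Conversely, the adjacency matrix of a complete graph is the all-ones matrix
    minus the identity, so its eigenvalues are -1 and [N - 1]
    ([complete_eigenvalue]), and by the vanishing of their sum [N - 1] occurs
    only once; thus the second eigenvalue is exactly -1.  A second eigenvalue
    below -1 would make the graph complete, hence be equal to -1: there is none. *)

(** Both sides are, up to sign, the subleading coefficient of [char_poly A]. *)
Lemma sum_spectrum (R : rcfType) m (A : 'M[R]_m) :
  A^T = A -> \sum_(x <- spectrum A) x = \tr A.
Proof.
case: m A => [|m] A sA.
  by have [_ _ /size0nil ->] := spectrum_symmetric sA; rewrite big_nil /mxtrace big_ord0.
have [pE _ sz] := spectrum_symmetric sA.
apply: oppr_inj; rewrite -char_poly_trace // pE.
by have := @coefPn_prod_XsubC _ (spectrum A); rewrite sz => ->.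
Qed.

Lemma spectrum_eigenvalue (R : rcfType) m (A : 'M[R]_m) x :
  A^T = A -> x \in spectrum A -> eigenvalue A x.
Proof.
move=> sA xA; have [pE _ _] := spectrum_symmetric sA.
by rewrite eigenvalue_root_char pE root_prod_XsubC.
Qed.

Section SimpleGraph.
Variables (R : rcfType) (T : finType) (e : rel T).
Local Notation A := (adjacency_mx R e).

Lemma adjacency_mx_trace : irreflexive e -> \tr A = 0.
Proof. by move=> ei; rewrite /mxtrace big1 // => i _; rewrite mxE ei. Qed.

(** Every term of the equation of a largest entry of an eigenvector must be as
    large as possible.  This shows first that all entries have the same absolute
    value, hence that the same equation is available at every vertex. *)
Lemma large_eigenvalue_complete (a : R) : irreflexive e ->
  eigenvalue A a -> #|T|.-1%:R <= a -> complete_graph e.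
Proof.
move=> ei /eigenvalueP[v vA vn0] Na.
have /rV0Pn[i0 vi0] := vn0.
have [k _ kmax] := @arg_maxP _ _ _ i0 xpredT (fun i => `|v 0 i|) isT.
set M := `|v 0 k| in kmax.
have M0 : 0 < M by apply: lt_le_trans (kmax i0 isT); rewrite normr_gt0.
have vM i : `|v 0 i| <= M by apply: kmax.
have tight i : `|v 0 i| = M -> forall j, j != i -> `|v 0 j| * A j i = M.
  move=> iM; suff h j : j != i -> M - `|v 0 j| * A j i = 0.
    by move=> j /h /subr0_eq.
  have term_ge0 l : l != i -> 0 <= M - `|v 0 l| * A l i.
    by move=> _; rewrite mxE subr_ge0; case: (e _ _); rewrite ?mulr1 ?mulr0 // ltW.
  (* Nonnegative terms vanish as soon as their sum is at most 0, which is what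
     the triangle inequality gives for entry [i] of [v *m A = a *: v]. *)
  move: j; apply: (psumr_eq0P term_ge0).
  apply/eqP; rewrite eq_le sumr_ge0 ?andbT // sumrB subr_le0.
  rewrite sumr_const cardC1 card_ord -mulr_natl.
  apply: le_trans (ler_wpM2r (ltW M0) Na) _.
  have a0 : 0 <= a by apply: le_trans Na; apply: ler0n.
  rewrite -iM -[a in a * _]ger0_norm // -normrM.
  have -> : a * v 0 i = \sum_j v 0 j * A j i.
    by have := congr1 (fun w : 'rV_ _ => w 0 i) vA; rewrite !mxE.
  rewrite (bigD1 i) //= [A i i]mxE ei mulr0 add0r.
  apply: le_trans (ler_norm_sum _ _ _) _; apply: ler_sum => l _.
  by rewrite normrM [`|A l i|]ger0_norm // mxE ler0n.
have adj i j : `|v 0 i| = M -> j != i -> A j i != 0.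
  by move=> iM ji; apply: contraTneq M0 => A0; rewrite -(tight i iM j ji) A0 mulr0 ltxx.
have allM i : `|v 0 i| = M.
  have [-> //|ik] := eqVneq i k; have := adj k i erefl ik; have := tight k erefl i ik.
  by rewrite mxE; case: (e _ _); rewrite ?mulr1 // eqxx.
move=> x y xy.
have := adj (enum_rank y) (enum_rank x) (allM _).
rewrite (inj_eq enum_rank_inj) => /(_ xy).
by rewrite mxE !enum_rankK; case: (e _ _); rewrite ?eqxx.
Qed.

(** An eigenvector [v] of eigenvalue [a] satisfies [(a + 1) v_j = \sum_i v_i] at
    every [j], so that [v] is constant unless [a = -1]; a nonzero constant [v]
    then gives [a + 1 = N]. *)
Lemma complete_eigenvalue (a : R) : irreflexive e -> complete_graph e ->
  eigenvalue A a -> a = -1 \/ a = #|T|.-1%:R.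
Proof.
move=> ei ec /eigenvalueP[v vA vn0].
have vS j : (a + 1) * v 0 j = \sum_i v 0 i.
  have := congr1 (fun w : 'rV_ _ => w 0 j) vA; rewrite !mxE mulrDl mul1r => <-.
  rewrite [in RHS](bigD1 j) //= (bigD1 j) //= mxE ei mulr0 add0r addrC.
  congr (_ + _); apply: eq_bigr => i ij; rewrite mxE ec ?mulr1 //.
  by rewrite (inj_eq enum_val_inj).
have [|a1] := eqVneq (a + 1) 0; [by left; lra|right].
have vc i j : v 0 i = v 0 j by apply: (mulfI a1); rewrite !vS.
have /rV0Pn[i vi] := vn0.
have T0 : (0 < #|T|)%N by apply: leq_ltn_trans (ltn_ord i).
have := vS i; rewrite (eq_bigr (fun=> v 0 i)) => [|j _]; last exact: vc.
rewrite sumr_const card_ord -[RHS]mulr_natl => h.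
by have := mulIf vi h; rewrite -[in RHS](prednK T0) -natr1 => /addIr.
Qed.

Lemma spectrum_cons2 : symmetric e -> irreflexive e -> (1 < #|T|)%N ->
  exists x t, let y := graph_eigenvalue R e 2 in
    [/\ spectrum A = [:: x, y & t], y <= x, all (<= y) t &
        x + y + \sum_(z <- t) z = 0 /\ #|T|.-1 = (size t).+1].
Proof.
move=> es ei T1; have sA := adjacency_mx_sym R es.
have [_ srt sz] := spectrum_symmetric sA.
have tr := sum_spectrum _ _ _ sA; rewrite adjacency_mx_trace // in tr.
rewrite /graph_eigenvalue.
case: (spectrum A) srt sz tr => [|x [|y t]] /=; try by move=> _ sz; rewrite -sz in T1.
move=> /andP[yx]; rewrite (path_sortedE ge_trans) => /andP[yt _] <-.
by rewrite !big_cons addrA => tr; exists x, t.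
Qed.

(** The other [N - 1] eigenvalues being at most -1, the zero sum pushes the first
    one up to at least [N - 1]. *)
Lemma eigenvalue2_le_complete : symmetric e -> irreflexive e ->
  (1 < #|T|)%N -> graph_eigenvalue R e 2 <= -1 -> complete_graph e.
Proof.
move=> es ei T1; have [x [t []]] := spectrum_cons2 es ei T1.
set y := graph_eigenvalue _ _ _ => sE yx yt [tr N1] y1.
apply: (large_eigenvalue_complete x) => //.
  by apply: spectrum_eigenvalue; rewrite ?adjacency_mx_sym // sE mem_head.
have : \sum_(z <- t) z <= \sum_(z <- t) -1.
  by rewrite big_seq [leRHS]big_seq; apply: ler_sum => z /(allP yt) /le_trans; apply.
rewrite big_const_seq count_predT iter_addr_0 N1 -natr1 mulNrn; lra.
Qed.

(** If the second eigenvalue were [N - 1], so would be the first, and the [N - 2]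
    remaining ones, each at least -1, could not bring the sum down to 0. *)
Lemma complete_eigenvalue2 : symmetric e -> irreflexive e ->
  (1 < #|T|)%N -> complete_graph e -> graph_eigenvalue R e 2 = -1.
Proof.
move=> es ei T1 ec; have [x [t []]] := spectrum_cons2 es ei T1.
set y := graph_eigenvalue _ _ _ => sE yx yt [tr N1].
have ev z : z \in spectrum A -> z = -1 \/ z = (size t).+1%:R.
  rewrite -N1 => zA; apply: complete_eigenvalue => //.
  by apply: spectrum_eigenvalue; rewrite ?adjacency_mx_sym.
have [//|yN] : y = -1 \/ y = (size t).+1%:R by apply: ev; rewrite sE !inE eqxx orbT.
have : \sum_(z <- t) -1 <= \sum_(z <- t) z.
  rewrite big_seq [leRHS]big_seq; apply: ler_sum => z zt.
  have /ev[->//|->] : z \in spectrum A by rewrite sE !inE zt !orbT.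
  by apply: le_trans (ler0n _ _); lra.
have := ler0n R (size t); rewrite -natr1 in yN.
rewrite big_const_seq count_predT iter_addr_0 mulNrn; lra.
Qed.

End SimpleGraph.

Theorem theorem2p2 (R : rcfType) (n : nat) (hn : (3 <= n)%N)
    (gT : finGroupType) (hcyclic : cyclic [set: gT])
    (hcard : #|[set: gT]| = n) :
  -1 <= graph_eigenvalue R (@power_graph gT) 2 /\
  (graph_eigenvalue R (@power_graph gT) 2 = -1 <->
   complete_graph (@power_graph gT)).
Proof.
have T1 : (1 < #|gT|)%N by rewrite -cardsT hcard ltnW.
have es := @power_graph_sym gT; have ei := @power_graph_irrefl gT.
have low := @eigenvalue2_le_complete R _ _ es ei T1.
have cpl := @complete_eigenvalue2 R _ _ es ei T1.
split; last by split=> [h|]; [apply: low; rewrite h | apply: cpl].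
by rewrite leNgt; apply/negP => lt; move: (lt); rewrite (cpl (low (ltW lt))) ltxx.
Qed.
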